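(* Let $p\in(0,1)$, let $0<u\le 1$ and let $(s,t)\in\mathbb{R}_+^2$ be fixed. Then $$\lim_{N\to\infty}\frac{G^{(u)}_{\lfloor Ns\rfloor,\lfloor Nt\rfloor}}{N}=su+t\,\frac{p(1-u)}{u+p(1-u)},\qquad \mathbb{P}\text{-a.s.}$$
   Context: Notation: $\mathbb{Z}_+=\{0,1,2,\dots\}$, $\mathbb{N}=\{1,2,\dots\}$, $\mathbb{R}_+=[0,\infty)$, $e_1=(1,0)$, $e_2=(0,1)$. Boundary environment $\omega^{(u)}=\{\omega^{(u)}_{i,j}\}_{(i,j)\in\mathbb{Z}_+^2}$: the weights are independent under $\mathbb{P}$, with $\omega^{(u)}_{i,j}\sim\mathrm{Ber}(p)$ for $i,j\ge1$, $\omega^{(u)}_{i,0}\sim\mathrm{Ber}(u)$ for $i\ge1$, $\omega^{(u)}_{0,j}\sim\mathrm{Ber}\big(\frac{p(1-u)}{u+p(1-u)}\big)$ for $j\ge 1$, and $\omega^{(u)}_{0,0}=0$. An admissible path from $(0,0)$ to $(m,n)\in\mathbb{Z}_+^2$ is a finite sequence of sites starting at $(0,0)$, ending at $(m,n)$, with all steps in $\{e_1,e_2,e_1+e_2\}$. It collects weight as follows: a step along the horizontal axis from $(k-1,0)$ to $(k,0)$ collects $\omega^{(u)}_{k,0}$; a step along the vertical axis from $(0,k-1)$ to $(0,k)$ collects $\omega^{(u)}_{0,k}$; a diagonal step $e_1+e_2$ into a site $v$ collects $\omega^{(u)}_v$; every other step collects $0$. The last passage time $G^{(u)}_{m,n}=G^{(u)}_{0,(m,n)}$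 is the maximum, over all admissible paths from $(0,0)$ to $(m,n)$, of the total collected weight. *)

(* Defs.v *)
From HB Require Import structures.
From mathcomp Require Import all_boot all_order all_algebra.
From mathcomp Require Import all_classical all_reals all_analysis.

Set Implicit Arguments.
Unset Strict Implicit.
Unset Printing Implicit Defensive.

Import Order.TTheory GRing.Theory Num.Theory.
Import numFieldNormedType.Exports.

Local Open Scope classical_set_scope.
Local Open Scope ring_scope.

Definition site : Type := (nat * nat)%type.

Definition step_e1 (a b : site) : bool := b == (a.1.+1, a.2).
Definition step_e2 (a b : site) : bool := b == (a.1, a.2.+1).
Definition step_e12 (a b : site) : bool := b == (a.1.+1, a.2.+1).

Definition admissible_step : rel site :=
  [rel a b | [|| step_e1 a b, step_e2 a b | step_e12 a b]].

(* As in [path], the initial site (0, 0) is not stored: [q] lists the sites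
   visited after it. *)
Definition admissible_path (v : site) (q : seq site) : bool :=
  path admissible_step (0, 0)%N q && (last (0, 0)%N q == v).

Definition step_weight (R : realType) (w : site -> R) (a b : site) : R :=
  if step_e12 a b then w b
  else if step_e1 a b && (a.2 == 0)%N then w b
  else if step_e2 a b && (a.1 == 0)%N then w b
  else 0.

Definition path_weight (R : realType) (w : site -> R) (q : seq site) : R :=
  \sum_(x <- pairmap (step_weight w) (0, 0)%N q) x.

(* The supremum is a maximum, see [last_passage_max]. *)
Definition last_passage (R : realType) (w : site -> R) (v : site) : R :=
  sup [set path_weight w q | q in [set q | admissible_path v q]].

Lemma finite_admissible_path (v : site) :
  finite_set [set q | admissible_path v q].
Proof.
have [k] := ubnP (v.1 + v.2)%N; elim: k => // k IH in v * => vk.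
pose S (i j : bool) (_ : i || j) : set (seq site) :=
  [set rcons q v | q in [set q |
     [&& (i <= v.1)%N, (j <= v.2)%N &
         admissible_path (v.1 - i, v.2 - j)%N q]]].
have Sfin i j (ij : i || j) : finite_set (S i j ij).
  apply: finite_image; have [iv|iv] := leqP i v.1; last first.
    by apply: (sub_finite_set _ (finite_set0 _)).
  have [jv|jv] := leqP j v.2; last first.
    by apply: (sub_finite_set _ (finite_set0 _)).
  apply: IH => /=; rewrite -ltnS; apply: leq_trans vk; rewrite ltnS.
  case: i j ij iv jv => [] [] //= _ iv jv; rewrite ?subn0 ?subn1.
  - by rewrite -(prednK iv) -(prednK jv) /= addSn addnS ltnS leqW.
  - by rewrite -{2}(prednK iv).
  - by rewrite -{2}(prednK jv) addnS.
apply: (@sub_finite_set _ _ ([set [::]] `|` (S true false isT `|`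
   (S false true isT `|` S true true isT)))); last first.
  by rewrite !finite_setU; do ![split=> //]; exact: finite_set1.
move=> q /=; case: (lastP q) => [|{}q b]; first by left.
rewrite /admissible_path rcons_path last_rcons => /andP[/andP[qP qb] /eqP bv].
right; move: qb; rewrite bv /step_e1 /step_e2 /step_e12 /=.
case E: (last _ q) => [a c] /=.
case/or3P => /eqP vE; [left|right; left|right; right]; exists q => //=;
  by rewrite /admissible_path qP E vE /= ?subn1 ?subn0 eqxx.
Qed.

Lemma admissible_path_ex (v : site) : exists q, admissible_path v q.
Proof.
have rowP i : exists q, admissible_path (i, 0)%N q.
  elim: i => [|i [q /andP[qP /eqP qE]]]; first by exists [::].
  exists (rcons q (i.+1, 0)%N).
  by rewrite /admissible_path rcons_path qP qE last_rcons /= /admissible_step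
    /= /step_e1 !eqxx.
case: v => i j; elim: j => [|j [q /andP[qP /eqP qE]]]; first exact: rowP.
exists (rcons q (i, j.+1)).
by rewrite /admissible_path rcons_path qP qE last_rcons /= /admissible_step
  /= /step_e2 !eqxx orbT.
Qed.

Lemma last_passage_max (R : realType) (w : site -> R) (v : site) :
  (exists2 q, admissible_path v q & last_passage w v = path_weight w q) /\
  (forall q, admissible_path v q -> path_weight w q <= last_passage w v).
Proof.
pose A : set R := [set path_weight w q | q in [set q | admissible_path v q]].
have [q0 q0P] := admissible_path_ex v.
have /finite_seqP[s As] : finite_set A.
  exact/finite_image/finite_admissible_path.
have A0 : A (path_weight w q0) by exists q0.
pose M := \big[Order.max/path_weight w q0]_(x <- s) x.
have MA : A M.
  rewrite /M big_seq; elim/big_ind: _ => // [x y Ax Ay|x xs].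
    by rewrite /Order.max; case: ifP.
  by rewrite As.
have MU : ubound A M.
  move=> x; rewrite As /= => xs; exact: bigmax_sup_seq xs _ _.
have GM : last_passage w v = M.
  apply/eqP; rewrite eq_le; apply/andP; split.
    by apply: ge_sup => //; exists (path_weight w q0).
  by apply: ub_le_sup => //; exists M.
split; first by case: MA => q qv qM; exists q => //; rewrite GM.
by move=> q qv; rewrite GM; apply: MU; exists q.
Qed.

(* [bernoulli_prob] is a law on [bool]; the law on [R] is its image under
   false |-> 0, true |-> 1. *)
Definition bernoulli_distributed d (T : measurableType d) (R : realType)
    (P : probability T R) (q : R) (X : {RV P >-> R}) : Prop :=
  forall A : set R, measurable A ->
    distribution P X A =
    pushforward (bernoulli_prob q) (fun b : bool => b%:R : R) A.

Arguments bernoulli_distributed {d T R} P q X.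

Definition independent_RVs d (T : measurableType d) (R : realType)
    (P : probability T R) (I : choiceType) (X : I -> {RV P >-> R}) : Prop :=
  forall (J : seq I) (A : I -> set R), uniq J ->
    (forall i, measurable (A i)) ->
    P (\bigcap_(i in [set` J]) (X i @^-1` A i)) =
    (\prod_(i <- J) P (X i @^-1` A i))%E.

Arguments independent_RVs {d T R} P {I} X.

Definition vertical_parameter (R : realType) (p u : R) : R :=
  p * (1 - u) / (u + p * (1 - u)).

Record boundary_environment d (T : measurableType d) (R : realType)
    (P : probability T R) (p u : R) (w : site -> {RV P >-> R}) : Prop := {
  env_indep : independent_RVs P w;
  env_bulk : forall i j : nat, (1 <= i)%N -> (1 <= j)%N ->
    bernoulli_distributed P p (w (i, j));
  env_horizontal : forall i : nat, (1 <= i)%N ->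
    bernoulli_distributed P u (w (i, 0%N));
  env_vertical : forall j : nat, (1 <= j)%N ->
    bernoulli_distributed P (vertical_parameter p u) (w (0%N, j));
  env_origin : forall x : T, w (0, 0)%N x = 0
}.

Arguments boundary_environment {d T R} P p u w.

(* Main.v *)
Require Import Defs.
From HB Require Import structures.
From mathcomp Require Import all_boot all_order all_algebra.
From mathcomp Require Import all_classical all_reals all_analysis.
From mathcomp Require Import measurable_realfun ring lra.

Import Order.TTheory GRing.Theory Num.Theory.
Import numFieldNormedType.Exports.

Local Open Scope classical_set_scope.
Local Open Scope ring_scope.

(** The boundary parameters u and v = p(1-u)/(u+p(1-u)) are chosen so that the
    model is stationary, in the manner of Burke's theorem for queues.

    The passage time G grows by 0 or 1 along every lattice edge.  If a and j are
    the increments along the bottom and left edges of a unit square whose upper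
    right corner has weight w, then the diagonal adds max(a, j, w), so the top
    and right increments are the functions [hout] and [vout] of (a, j, w).  When
    a, j, w are independent Ber(u), Ber(v), Ber(p), the pair (hout, vout) is
    again independent Ber(u), Ber(v): this is a three-bit computation
    ([Ebern_burke]) and the only place where the relation between u and v enters.
    Sweeping the squares of a column from bottom to top and then the columns from
    left to right ([Eprod_colstep], [law_vert]) shows that the increments of G
    along any vertical line are independent Ber(v).

    Following the bottom axis to (m, 0) and then the vertical line up to (m, n)
    writes G(m, n) as a sum of m independent Ber(u) bits plus a sum of n
    independent Ber(v) bits ([flow_passage], [last_passage_flow]).  The two sums
    are dependent, and the second one uses a different family of bits for every
    m, so the strong law cannot be applied to one fixed sequence.  Instead each
    sum of k centered bits has fourth moment at most 3 k^2
    ([Eprod_fourth_moment_le]); with k = O(N) the fourth moments of the rescaled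
    sums are summable in N, hence the rescaled sums tend to 0 almost surely
    ([ae_cvg_fourth_moment]).  What is left of G/N is
    (floor(Ns)/N) u + (floor(Nt)/N) v, which tends to s u + t v.

    Expectations of functions of finitely many bits are handled as iterated
    finite averages [Eprod]; [integral_bits] identifies them with integrals on
    the probability space. *)

(** * Averages over independent bits *)

Definition Ebern (R : realType) (q : R) (f : bool -> R) : R :=
  q * f true + (1 - q) * f false.

Fixpoint Eprod (R : realType) (ps : seq R) (f : seq bool -> R) : R :=
  if ps is q :: ps' then Ebern R q (fun b => Eprod R ps' (fun s => f (b :: s)))
  else f [::].

Arguments Ebern {R} q f.
Arguments Eprod {R} ps f.

Lemma eq_Ebern (R : realType) (q : R) (f g : bool -> R) :
  f =1 g -> Ebern q f = Ebern q g.
Proof. by move=> fg; rewrite /Ebern !fg. Qed.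

(** The restriction to sequences of the right length is what makes [take] and
    [drop] invert a concatenation when blocks of bits are averaged together. *)
Lemma eq_Eprod_size (R : realType) (ps : seq R) (f g : seq bool -> R) :
  (forall s, size s = size ps -> f s = g s) -> Eprod ps f = Eprod ps g.
Proof.
elim: ps f g => [|q ps IH] f g fg /=; first exact: fg.
by apply: eq_Ebern => b; apply: IH => s sz; apply: fg; rewrite /= sz.
Qed.

Lemma eq_Eprod (R : realType) (ps : seq R) (f g : seq bool -> R) :
  f =1 g -> Eprod ps f = Eprod ps g.
Proof. by move=> /funext ->. Qed.

Lemma Eprod_cat (R : realType) (ps qs : seq R) (f : seq bool -> R) :
  Eprod (ps ++ qs) f = Eprod ps (fun s => Eprod qs (fun t => f (s ++ t))).
Proof. by elim: ps f => [|q ps IH] f //=; apply: eq_Ebern => b; rewrite IH. Qed.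

Lemma Ebern_swap (R : realType) (q r : R) (f : bool -> bool -> R) :
  Ebern q (fun b => Ebern r (f b)) = Ebern r (fun c => Ebern q (f^~ c)).
Proof. by rewrite /Ebern; ring. Qed.

Lemma Ebern_Eprod_swap (R : realType) (q : R) (ps : seq R)
    (f : bool -> seq bool -> R) :
  Ebern q (fun b => Eprod ps (f b)) = Eprod ps (fun s => Ebern q (f^~ s)).
Proof.
elim: ps f => [|r ps IH] f //=.
by rewrite Ebern_swap; apply: eq_Ebern => c; rewrite IH.
Qed.

(** The sum of the [b - q] has cumulants proportional to [n], which gives the
    closed form below.  The shift [c] makes the induction on [n] immediate: the
    first bit is absorbed into [c], and averaging over it is a ring identity. *)
Lemma Eprod_fourth_moment (R : realType) (q c : R) (n : nat) :
  Eprod (nseq n q) (fun s => (c + \sum_(b <- s) (b%:R - q)) ^+ 4) =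
  c ^+ 4 + 6 * c ^+ 2 * n%:R * (q * (1 - q))
  + 4 * c * n%:R * (q * (1 - q) * (1 - 2 * q))
  + n%:R * (q * (1 - q) * (1 - 3 * q + 3 * q ^+ 2))
  + 3 * n%:R * (n%:R - 1) * (q * (1 - q)) ^+ 2.
Proof.
elim: n c => [|n IH] c /=; first by rewrite big_nil; ring.
have E b : Eprod (nseq n q)
    (fun s => (c + \sum_(b <- b :: s) (b%:R - q)) ^+ 4) =
    Eprod (nseq n q)
    (fun s => ((c + (b%:R - q)) + \sum_(b <- s) (b%:R - q)) ^+ 4).
  by apply: eq_Eprod => s; rewrite big_cons addrA.
by rewrite /Ebern !E !IH -natr1 /=; ring.
Qed.

Lemma Eprod_fourth_moment_le (R : realType) (q : R) (n : nat) :
  0 <= q <= 1 ->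
  Eprod (nseq n q) (fun s => (\sum_(b <- s) (b%:R - q)) ^+ 4) <=
  3 * n%:R ^+ 2.
Proof.
move=> /andP[q0 q1].
have -> : Eprod (nseq n q) (fun s => (\sum_(b <- s) (b%:R - q)) ^+ 4) =
    Eprod (nseq n q) (fun s => (0 + \sum_(b <- s) (b%:R - q)) ^+ 4).
  by apply: eq_Eprod => s; rewrite add0r.
rewrite Eprod_fourth_moment.
have a0 : 0 <= q * (1 - q) by nra.
have a1 : q * (1 - q) <= 1 by nra.
have b1 : 1 - 3 * q + 3 * q ^+ 2 <= 1 by nra.
have b0 : 0 <= 1 - 3 * q + 3 * q ^+ 2 by nra.
have ab : q * (1 - q) * (1 - 3 * q + 3 * q ^+ 2) <= 1 by nra.
have aa : (q * (1 - q)) ^+ 2 <= 1 by nra.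
case: n => [|n]; first by nra.
have n1 : (1 : R) <= n.+1%:R by rewrite ler1n.
have E1 := ler_wpM2l (ler0n R n.+1) ab.
have nn : (0 : R) <= 3 * n.+1%:R * (n.+1%:R - 1) by nra.
have E2 := ler_wpM2l nn aa.
by nra.
Qed.

(** * The Burke property *)

(** Increment of the passage time along the top edge of a unit square, from the
    increments [a] (bottom) and [j] (left) and the corner weight [w]: it equals
    [max(a, j, w) - j]. *)
Definition hout (a j w : bool) : bool := ~~ j && (a || w).

(** Increment along the right edge of the same square: [max(a, j, w) - a]. *)
Definition vout (a j w : bool) : bool := ~~ a && (j || w).

(** The bits (hout, vout) are (1,1) only when a = j = 0 and w = 1, which has
    probability (1-u)(1-v)p, and this equals u v for the stationary value of v;
    the marginals agree as well, so the pair has the law of (a, j). *)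
Lemma Ebern_burke (R : realType) (p u : R) (g : bool -> bool -> R) :
  u + p * (1 - u) != 0 ->
  Ebern u (fun a => Ebern (vertical_parameter p u) (fun j =>
    Ebern p (fun w => g (hout a j w) (vout a j w)))) =
  Ebern u (fun a => Ebern (vertical_parameter p u) (g a)).
Proof.
by move=> D0; rewrite /Ebern /vertical_parameter /hout /vout /=; field.
Qed.

(** Transfer across one column of squares, from bottom to top: [a] is the
    increment along the bottom edge, [js] and [ws] list the left increments and
    the weights.  The result lists the right increments and gives the increment
    along the top edge. *)
Fixpoint colstep (a : bool) (js ws : seq bool) : seq bool * bool :=
  match js, ws with
  | j :: js', w :: ws' =>
    let r := colstep (hout a j w) js' ws' in (vout a j w :: r.1, r.2)
  | _, _ => ([::], a)
  end.

(** The outgoing top increment is carried along because it is the incoming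
    bottom increment of the next square: [Ebern_burke] for the lowest square
    makes it independent of the right increment already produced, so that the
    induction hypothesis applies to the remaining squares. *)
Lemma Eprod_colstep (R : realType) (p u : R) (n : nat)
    (f : seq bool * bool -> R) : u + p * (1 - u) != 0 ->
  Ebern u (fun a => Eprod (nseq n (vertical_parameter p u)) (fun js =>
    Eprod (nseq n p) (fun ws => f (colstep a js ws)))) =
  Ebern u (fun a => Eprod (nseq n (vertical_parameter p u)) (fun js =>
    f (js, a))).
Proof.
move=> D0; elim: n f => [|n IH] f //=.
set v := vertical_parameter p u in IH *.
(* [g a j] is the average over all squares but the lowest, whose top and right
   increments are [a] and [j]. *)
pose g a j := Eprod (nseq n v) (fun js => Eprod (nseq n p) (fun ws =>
  let r := colstep a js ws in f (j :: r.1, r.2))).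
transitivity (Ebern u (fun a => Ebern v (fun j => Ebern p (fun w =>
    g (hout a j w) (vout a j w))))).
  apply: eq_Ebern => a; apply: eq_Ebern => j.
  by rewrite -Ebern_Eprod_swap.
rewrite Ebern_burke// Ebern_swap [RHS]Ebern_swap; apply: eq_Ebern => j.
exact: (IH (fun r => f (j :: r.1, r.2))).
Qed.

(** * The passage time as a sum of increments *)

(** Increment from (i-1, j) to (i, j), given the increments [V] along the
    vertical line just to the left.  It is separated from [vert] so that the two
    mutually dependent families of increments are structurally recursive. *)
Fixpoint horiz_from (e : site -> bool) (V : nat -> bool) (i j : nat) : bool :=
  if j is j'.+1 then hout (horiz_from e V i j') (V j) (e (i, j))
  else e (i, 0%N).

(** Increment from (i, j-1) to (i, j); the value at j = 0 is junk for i > 0. *)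
Fixpoint vert (e : site -> bool) (i j : nat) : bool :=
  match i, j with
  | i'.+1, j'.+1 =>
    vout (horiz_from e (vert e i') i j') (vert e i' j) (e (i, j))
  | 0%N, _ => e (0%N, j)
  | _, 0%N => false
  end.

(** Increment from (i, j) to (i+1, j). *)
Definition horiz (e : site -> bool) (i j : nat) : bool :=
  horiz_from e (vert e i) i.+1 j.

(** The sum of the increments along the horizontal axis up to (v.1, 0), then up
    the vertical line to v.  For 0/1 weights it equals the last passage time. *)
Definition flow_passage (e : site -> bool) (v : site) : nat :=
  (\sum_(k < v.1) e (k.+1, 0) + \sum_(k < v.2) vert e v.1 k.+1)%N.

Lemma flow_passage_e2 (e : site -> bool) (i j : nat) :
  flow_passage e (i, j.+1) = (flow_passage e (i, j) + vert e i j.+1)%N.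
Proof. by rewrite /flow_passage /= big_ord_recr addnA. Qed.

(** The increments around each unit square are consistent, since
    [a + vout = j + hout]; so [horiz] is the horizontal increment of
    [flow_passage] although only [vert] enters its definition above the axis. *)
Lemma flow_passage_e1 (e : site -> bool) (i j : nat) :
  flow_passage e (i.+1, j) = (flow_passage e (i, j) + horiz e i j)%N.
Proof.
elim: j => [|j IH].
  by rewrite /flow_passage /= !big_ord0 !addn0 big_ord_recr.
rewrite !flow_passage_e2 IH -!addnA; congr (_ + _)%N.
rewrite /horiz /= -/(horiz e i j).
by case: (horiz e i j); case: (vert e i j.+1); case: (e _).
Qed.

Lemma flow_passage_e12 (e : site -> bool) (i j : nat) :
  flow_passage e (i.+1, j.+1) =
  (flow_passage e (i, j) +
     [|| horiz e i j, vert e i j.+1 | e (i.+1, j.+1)])%N.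
Proof.
rewrite flow_passage_e1 flow_passage_e2 -addnA; congr (_ + _)%N.
rewrite /horiz /= -/(horiz e i j).
by case: (horiz e i j); case: (vert e i j.+1); case: (e _).
Qed.

(** Along any step [flow_passage] grows by at least the collected weight; summed
    over a path this bounds the path weight from above. *)
Lemma step_weight_le (R : realType) (e : site -> bool) (a b : site) :
  admissible_step a b ->
  (flow_passage e a)%:R + step_weight (fun v => (e v)%:R : R) a b <=
  (flow_passage e b)%:R.
Proof.
case: a => i j; rewrite /admissible_step /step_weight /=.
rewrite /step_e1 /step_e2 /step_e12 /=.
case/or3P => /eqP ->; rewrite !xpair_eqE !eqxx ?(gtn_eqF (ltnSn _));
  rewrite ?(ltn_eqF (ltnSn _)) /=.
- rewrite flow_passage_e1 natrD lerD2l.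
  by case: eqP => [->|] /=; rewrite ?ler0n.
- rewrite flow_passage_e2 natrD lerD2l.
  by case: eqP => [->|] /=; rewrite ?ler0n.
- rewrite flow_passage_e12 -natrD ler_nat leq_add2l.
  by case: (e _); rewrite ?orbT.
Qed.

Lemma path_weight_le_flow (R : realType) (e : site -> bool) (v : site)
    (q : seq site) : admissible_path v q ->
  path_weight (fun v => (e v)%:R : R) q <= (flow_passage e v)%:R.
Proof.
rewrite /admissible_path /path_weight => /andP[qP /eqP <-].
have : (flow_passage e (0, 0))%:R +
    \sum_(x <- pairmap (step_weight (fun v => (e v)%:R)) (0, 0)%N q) x <=
    (flow_passage e (last (0, 0)%N q))%:R :> R.
  elim: q (0, 0)%N qP => [|b q IH] a /=; first by rewrite big_nil addr0.
  move=> /andP[ab /IH]; apply: le_trans.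
  by rewrite big_cons addrA lerD2r step_weight_le.
by rewrite /flow_passage /= !big_ord0 add0r.
Qed.

(** Every site has a last step whose weight accounts exactly for the growth of
    [flow_passage]: the step along the axis for a site on an axis; otherwise the
    diagonal one if the site has weight 1, and else a vertical or horizontal one
    along which the increment is 0, which exists because [hout] and [vout] are
    not both 1 when w = 0. *)
Lemma flow_predecessor (R : realType) (e : site -> bool) (b : site) :
  (0 < b.1 + b.2)%N -> exists a : site,
  [/\ (a.1 + a.2 < b.1 + b.2)%N, admissible_step a b &
    (flow_passage e b)%:R =
    (flow_passage e a)%:R + step_weight (fun v => (e v)%:R : R) a b].
Proof.
case: b => [[|i] [|j]] // _.
- exists (0, j)%N; split; rewrite /= ?addnS//.
    by rewrite /admissible_step /= /step_e2 eqxx ?orbT.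
  rewrite /step_weight /step_e1 /step_e2 /step_e12 /=.
  by rewrite flow_passage_e2 natrD !xpair_eqE !eqxx.
- exists (i, 0)%N; split; rewrite /= ?addSn//.
    by rewrite /admissible_step /= /step_e1 eqxx ?orbT.
  rewrite /step_weight /step_e1 /step_e2 /step_e12 /=.
  by rewrite flow_passage_e1 natrD !xpair_eqE !eqxx.
have [hw|hw] := boolP (e (i.+1, j.+1)).
  exists (i, j); split; rewrite /= ?addSn ?addnS ?ltnS ?leqW//.
    by rewrite /admissible_step /= /step_e12 eqxx ?orbT.
  by rewrite flow_passage_e12 hw !orbT natrD /step_weight /step_e12 eqxx hw.
have [ha|ha] := boolP (horiz e i j).
  exists (i.+1, j); split; rewrite /= ?addnS//.
    by rewrite /admissible_step /= /step_e2 eqxx ?orbT.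
  rewrite flow_passage_e2 /step_weight /step_e12 /step_e1 /step_e2.
  rewrite !xpair_eqE /= !(ltn_eqF (ltnSn _)) /= andbF addr0.
  by rewrite -/(horiz e i j) /vout ha addn0.
exists (i, j.+1); split; rewrite /= ?addSn//.
  by rewrite /admissible_step /= /step_e1 eqxx.
rewrite flow_passage_e1 /step_weight /step_e12 /step_e1 /step_e2.
rewrite !xpair_eqE /= !(ltn_eqF (ltnSn _)) /= !andbF /= addr0.
by rewrite /horiz /= -/(horiz e i j) /hout (negbTE ha) (negbTE hw) andbF addn0.
Qed.

Lemma last_passage_flow (R : realType) (e : site -> bool) (v : site) :
  last_passage (fun v => (e v)%:R : R) v = (flow_passage e v)%:R.
Proof.
have [[q0 q0P q0E] Gub] := last_passage_max (fun v => (e v)%:R : R) v.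
apply/eqP; rewrite eq_le {1}q0E path_weight_le_flow//=.
suff [q qv <-] : exists2 q, admissible_path v q &
    path_weight (fun v => (e v)%:R : R) q = (flow_passage e v)%:R by exact: Gub.
(* An optimal path is built backwards from v. *)
have [k] := ubnP (v.1 + v.2)%N; elim: k v {q0 q0P q0E Gub} => // k IH v vk.
have [v0|v0] := posnP (v.1 + v.2)%N.
  exists [::]; last by case: v v0 {vk} => [[|i] [|j]] //;
    rewrite /path_weight /flow_passage /= big_nil !big_ord0.
  by case: v v0 {vk} => [[|i] [|j]].
have [a [av ab ->]] := flow_predecessor R e v v0.
have [|q /andP[qP /eqP qa] <-] := IH a.
  by rewrite -ltnS; apply: leq_trans vk; rewrite ltnS.
exists (rcons q v).
  by rewrite /admissible_path rcons_path last_rcons qP qa ab /=.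
rewrite /path_weight -cats1 pairmap_cat /= big_cat /= qa.
by rewrite big_cons big_nil addr0.
Qed.

(** * Independent bits on a probability space *)

(** The product rule is stated for full assignments of values on a finite list,
    the form in which conditioning on bits one at a time uses it. *)
Definition independent_bits (d : measure_display) (T : measurableType d)
    (R : realType) (P : probability T R) (I : eqType) (prm : I -> R)
    (X : I -> T -> bool) : Prop :=
  (forall i, measurable_fun setT (X i)) /\
  forall (l : seq I) (b : I -> bool), uniq l ->
    P [set x | all (fun i => X i x == b i) l] =
    (\prod_(i <- l) (if b i then prm i else 1 - prm i))%:E.

Arguments independent_bits {d T R} P {I} prm X.

Lemma measurable_bits (d : measure_display) (T : measurableType d)
    (R : realType) (I : eqType) (X : I -> T -> bool) (l : seq I)
    (f : seq bool -> R) : (forall i, measurable_fun setT (X i)) ->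
  measurable_fun setT (fun x => f [seq X i x | i <- l]).
Proof.
move=> mX; elim: l f => [|i l IH] f /=; first exact: measurable_cst.
rewrite (_ : (fun _ => _) = fun x => if X i x
    then f (true :: [seq X j x | j <- l])
    else f (false :: [seq X j x | j <- l])); last first.
  by apply/funext => x; case: (X i x).
by apply: measurable_fun_ifT => //; apply: (IH (fun s => f (_ :: s))).
Qed.

Lemma measurable_bits_event (d : measure_display) (T : measurableType d)
    (I : eqType) (X : I -> T -> bool) (l : seq I) (b : I -> bool) :
  (forall i, measurable_fun setT (X i)) ->
  measurable [set x | all (fun i => X i x == b i) l].
Proof.
move=> mX; elim: l => [|i l IH] /=.
  by rewrite (_ : [set _ | _] = setT)//; apply/seteqP; split.
rewrite (_ : [set _ | _] = (X i @^-1` [set b i]) `&`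
    [set x | all (fun i => X i x == b i) l]); last first.
  by apply/seteqP; split => x /= => [/andP[/eqP]|[-> ->]]; rewrite ?eqxx.
by apply: measurableI => //; rewrite -[X in measurable X]setTI; apply: mX.
Qed.

(** Revealing the bits of [l2] one at a time: splitting the event according to
    the next bit turns the integral into the sum of two integrals over events
    of the same kind, which is the recursion of [Eprod].  The list [l1] of bits
    already revealed is there for the induction. *)
Lemma integral_bits_cond (d : measure_display) (T : measurableType d)
    (R : realType) (P : probability T R) (I : eqType) (prm : I -> R)
    (X : I -> T -> bool) (l1 l2 : seq I) (b : I -> bool) (f : seq bool -> R) :
  independent_bits P prm X -> uniq (l1 ++ l2) -> (forall s, 0 <= f s) ->
  (\int[P]_(x in [set x | all (fun i => X i x == b i) l1])
     (f [seq X i x | i <- l2])%:E =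
  ((\prod_(i <- l1) (if b i then prm i else 1 - prm i)) *
    Eprod [seq prm i | i <- l2] f)%:E)%E.
Proof.
move=> [mX XP] + f0; elim: l2 l1 b f f0 => [|i l2 IH] l1 b f f0.
  rewrite cats0 => ul1 /=.
  rewrite integral_cst; last exact: measurable_bits_event.
  by rewrite /= XP// -EFinM mulrC.
move=> ul.
have ul' : uniq ((i :: l1) ++ l2) by move: ul; rewrite -(cat1s i l2) uniq_catCA.
have il1 : i \notin l1 by case/andP: ul'; rewrite mem_cat => /norP[].
(* The assignment [b] is overridden by [c] at the revealed site [i], which
   does not occur in [l1]. *)
pose bi c j := if j == i then c else b j.
pose A c := [set x | all (fun j => X j x == bi c j) (i :: l1)].
have biE c j : j \in l1 -> bi c j = b j.
  by rewrite /bi => jl; case: (eqVneq j i) => // ji; rewrite -ji jl in il1.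
have bE c x :
    all (fun j => X j x == bi c j) l1 = all (fun j => X j x == b j) l1.
  by apply: eq_in_all => j jl; rewrite biE.
have AU : [set x | all (fun j => X j x == b j) l1] = A true `|` A false.
  apply/seteqP; rewrite /A /=; split => x /=; rewrite !bE {1 2}/bi eqxx.
    by move=> ->; case: (X i x); [left|right].
  by case=> /andP[].
have AiE c : (\int[P]_(x in A c) (f [seq X j x | j <- i :: l2])%:E =
    \int[P]_(x in A c) (f (c :: [seq X j x | j <- l2]))%:E)%E.
  apply: eq_integral => x; rewrite inE /A /= /bi eqxx => /andP[/eqP -> _] //.
have mA c : measurable (A c) by apply: measurable_bits_event.
rewrite AU ge0_integral_setU//; last 3 first.
- apply: (measurable_funS measurableT) => //; apply/measurable_EFinP.
  exact: (measurable_bits _ _ _ _ X (i :: l2) f mX).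
- by move=> x _; rewrite lee_fin.
- rewrite disj_set2E; apply/eqP/seteqP; split => x //= [].
  by rewrite /A /= /bi eqxx => /andP[/eqP -> _] /andP[].
have bP c : \prod_(j <- l1) (if bi c j then prm j else 1 - prm j) =
    \prod_(j <- l1) (if b j then prm j else 1 - prm j).
  rewrite big_seq [RHS]big_seq; apply: eq_bigr => j jl.
  by rewrite biE.
rewrite !AiE /A !(IH _ _ (fun s => f (_ :: s)))// -EFinD; congr (_%:E).
by rewrite !big_cons !bP /bi !eqxx /= /Ebern; ring.
Qed.

Lemma integral_bits (d : measure_display) (T : measurableType d)
    (R : realType) (P : probability T R) (I : eqType) (prm : I -> R)
    (X : I -> T -> bool) (l : seq I) (f : seq bool -> R) :
  independent_bits P prm X -> uniq l -> (forall s, 0 <= f s) ->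
  (\int[P]_x (f [seq X i x | i <- l])%:E =
   (Eprod [seq prm i | i <- l] f)%:E)%E.
Proof.
move=> XP ul f0.
have := integral_bits_cond _ _ _ _ _ _ _ [::] l (fun=> true) f XP ul f0.
rewrite big_nil mul1r => <-; congr (integral _ _ _).
by apply/seteqP; split.
Qed.

(** * The bits of the environment *)

(** The constant weight 0 at the origin is treated as a Ber(0) bit, so that all
    sites form one family. *)
Definition site_parameter (R : realType) (p u : R) (v : site) : R :=
  match v with
  | (0, 0)%N => 0
  | (0, _)%N => vertical_parameter p u
  | (_, 0)%N => u
  | _ => p
  end.

(** The weights lie in {0, 1} only almost surely; [bit] is an everywhere defined
    0/1 version of them. *)
Definition bit (T : Type) (R : realType) (w : site -> T -> R) (v : site)
  (x : T) : bool := w v x == 1.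

Arguments site_parameter {R} p u v.
Arguments bit {T R} w v x.

Lemma vertical_parameter_itv (R : realType) (p u : R) :
  0 < p < 1 -> 0 < u <= 1 -> 0 <= vertical_parameter p u <= 1.
Proof.
move=> /andP[p0 p1] /andP[u0 u1]; rewrite /vertical_parameter.
have D0 : 0 < u + p * (1 - u) by nra.
by rewrite divr_ge0 ?ler_pdivrMr ?(ltW D0)//= ?mul1r; nra.
Qed.

Lemma bernoulli_distributed_1 (d : measure_display) (T : measurableType d)
    (R : realType) (P : probability T R) (q : R) (X : {RV P >-> R}) :
  0 <= q <= 1 -> bernoulli_distributed P q X ->
  P (X @^-1` [set 1]) = q%:E /\ P (X @^-1` [set 0; 1]) = 1%E.
Proof.
move=> q01 XP; split.
  have := XP [set 1] (measurable_set1 _).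
  rewrite /distribution /pushforward /= => ->.
  rewrite bernoulli_probE// !diracE mem_set// memNset/=; last first.
    by move/esym/eqP; rewrite oner_eq0.
  by rewrite mule1 mule0 adde0.
have := XP [set 0; 1] _.
rewrite /distribution /pushforward /= => ->.
  rewrite bernoulli_probE// !diracE !mem_set/=; [|by left|by right].
  by rewrite !mule1 -EFinD; congr (_%:E); exact: subrKC.
exact: measurableU.
Qed.

(** The first equation gives the law of the bit at [v]; the second one is what
    makes the weight equal to its bit almost surely. *)
Lemma environment_site (d : measure_display) (T : measurableType d)
    (R : realType) (P : probability T R) (p u : R) (w : site -> {RV P >-> R})
    (v : site) : 0 < p < 1 -> 0 < u <= 1 -> boundary_environment P p u w ->
  P (w v @^-1` [set 1]) = (site_parameter p u v)%:E /\
  P (w v @^-1` [set 0; 1]) = 1%E.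
Proof.
move=> p01 u01 [_ wp wu wv w0].
have p01' : 0 <= p <= 1 by lra.
have u01' : 0 <= u <= 1 by lra.
have v01 := vertical_parameter_itv R p u p01 u01.
case: v => [[|i] [|j]] /=.
- split.
    rewrite (_ : _ @^-1` _ = set0) ?measure0//; apply/seteqP; split => x //=.
    by rewrite w0 => /esym/eqP; rewrite oner_eq0.
  rewrite (_ : _ @^-1` _ = setT) ?probability_setT//; apply/seteqP.
  by split => x //= _; left; rewrite w0.
- exact: bernoulli_distributed_1 (wv _ _).
- exact: bernoulli_distributed_1 (wu _ _).
- exact: bernoulli_distributed_1 (wp _ _ _ _).
Qed.

Lemma environment_bits (d : measure_display) (T : measurableType d)
    (R : realType) (P : probability T R) (p u : R) (w : site -> {RV P >-> R}) :
  0 < p < 1 -> 0 < u <= 1 -> boundary_environment P p u w ->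
  independent_bits P (site_parameter p u) (bit w).
Proof.
move=> p01 u01 hw; split => [v|l b ul].
  apply: (measurable_fun_bool true) => //; rewrite setTI.
  rewrite (_ : _ @^-1` _ = w v @^-1` [set 1]).
    by rewrite -[X in measurable X]setTI; exact: measurable_funP.
  by apply/seteqP; split => x /=; rewrite /bit => /eqP.
pose A (v : site) : set R := if b v then [set 1] else ~` [set 1].
have mA v : measurable (A v).
  by rewrite /A; case: ifP => // _; apply: measurableC.
have := env_indep hw ul mA.
rewrite (_ : \bigcap_(i in _) _ =
    [set x | all (fun v => bit w v x == b v) l]).
  move=> ->; rewrite -prodEFin; apply: eq_bigr => v _.
  have [w1 _] := environment_site d T R P p u w v p01 u01 hw.
  rewrite /A; case: ifP => // _.
  by rewrite -preimage_setC probability_setC ?w1 -?EFinB//.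
apply/seteqP; split => x /=.
  move=> H; apply/allP => v vl; have := H v vl; rewrite /A /bit /=.
  by case: (b v) => /= /eqP; [move->|move/negbTE->].
move=> /allP H v vl; have := H v vl; rewrite /A /bit /=.
by case: (b v) => /eqP; [move/eqP|move/negbT/eqP].
Qed.

Lemma environment_bit_ae (d : measure_display) (T : measurableType d)
    (R : realType) (P : probability T R) (p u : R) (w : site -> {RV P >-> R}) :
  0 < p < 1 -> 0 < u <= 1 -> boundary_environment P p u w ->
  {ae P, forall x, forall v, w v x = (bit w v x)%:R}.
Proof.
move=> p01 u01 hw.
have H : {ae P, forall x, forall i j, w (i, j) x = (bit w (i, j) x)%:R}.
  apply: ae_foralln => i; apply: ae_foralln => j.
  have mE : measurable (w (i, j) @^-1` [set 0; 1]).
    rewrite -[X in measurable X]setTI.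
    by apply: measurable_funP => //; apply: measurableU.
  exists (~` (w (i, j) @^-1` [set 0; 1])); split.
  - exact: measurableC.
  - apply: etrans (probability_setC P mE) _.
    have [_ ->] := environment_site d T R P p u w (i, j) p01 u01 hw.
    by rewrite subee.
  - move=> x /= nE [] wE; apply: nE; rewrite /bit wE ?eqxx//.
    by rewrite eq_sym oner_eq0.
by apply: filterS H => x H [i j].
Qed.

(** * The law of the vertical increments *)

(** [colstep] carries the increments of column [m] to those of column [m.+1],
    here over the rows k+1, ..., k+n. *)
Lemma colstep_vert (e : site -> bool) (m k n : nat) :
  colstep (horiz e m k) [seq vert e m j | j <- iota k.+1 n]
    [seq e (m.+1, j) | j <- iota k.+1 n] =
  ([seq vert e m.+1 j | j <- iota k.+1 n], horiz e m (k + n)).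
Proof.
elim: n k => [|n IH] k /=; first by rewrite addn0.
by have := IH k.+1; rewrite addSnnS {1}/horiz /= -/(horiz e m k) => ->.
Qed.

Lemma map_iota_const (A : Type) (g : nat -> A) (c : A) (n : nat) :
  (forall j, (0 < j)%N -> g j = c) -> [seq g j | j <- iota 1 n] = nseq n c.
Proof. by move=> gc; elim: n 0%N => //= n IH k; rewrite gc ?IH. Qed.

(** The increments along the line of abscissa [m] depend only on weights of
    columns up to [m].  The induction on [m] therefore carries their law jointly
    with that of any list [l] of bits strictly to the right: the bits of column
    [m.+1] are prepended to [l], and [Eprod_colstep] absorbs them. *)
Lemma law_vert (d : measure_display) (T : measurableType d)
    (R : realType) (P : probability T R) (p u : R) (X : site -> T -> bool)
    (m n : nat) (l : seq site) (f : seq bool -> seq bool -> R) :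
  u + p * (1 - u) != 0 ->
  independent_bits P (site_parameter p u) X ->
  uniq l -> all (fun v : site => m < v.1)%N l -> (forall s t, 0 <= f s t) ->
  (\int[P]_x (f [seq vert (X^~ x) m j | j <- iota 1 n]
      [seq X v x | v <- l])%:E =
   (Eprod (nseq n (vertical_parameter p u)) (fun s =>
      Eprod [seq site_parameter p u v | v <- l] (f s)))%:E)%E.
Proof.
move=> D0 XP; set v0 := vertical_parameter p u.
elim: m l f => [|m IH] l f ul lm f0.
  pose l0 := [seq (0, j)%N | j <- iota 1 n].
  have sl0 : size l0 = n by rewrite size_map size_iota.
  have ul0 : uniq (l0 ++ l).
    rewrite cat_uniq map_inj_uniq ?iota_uniq ?ul ?andbT; last by move=> i j [].
    apply/hasPn => v /(allP lm); apply: contraTN => /mapP[j _ ->].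
    by rewrite ltnn.
  transitivity (\int[P]_x ((fun s => f (take n s) (drop n s))
      [seq X v x | v <- l0 ++ l])%:E)%E.
    apply: eq_integral => x _; rewrite map_cat.
    rewrite take_size_cat ?size_map ?size_iota//.
    rewrite drop_size_cat ?size_map ?size_iota// /l0 -map_comp.
    by congr (f _ _)%:E; apply: eq_map => -[].
  apply: etrans (integral_bits _ _ _ P _ _ X (l0 ++ l)
    (fun s => f (take n s) (drop n s)) XP ul0 _) _ => //; congr (_%:E).
  rewrite map_cat Eprod_cat.
  have -> : [seq site_parameter p u v | v <- l0] = nseq n v0.
    by rewrite /l0 -map_comp; apply: map_iota_const => -[].
  apply: eq_Eprod_size => s; rewrite size_nseq => sn.
  by apply: eq_Eprod => t; rewrite take_size_cat ?drop_size_cat.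
pose l1 := [seq (m.+1, j) | j <- iota 1 n].
have sl1 : size l1 = n by rewrite size_map size_iota.
(* [t] starts with the bit of the horizontal axis, followed by the n weights
   of column m.+1, followed by the bits of [l]. *)
pose g js t := if t is a :: t' then
  f (colstep a js (take n t')).1 (drop n t') else 0.
have ul1 : uniq ((m.+1, 0)%N :: l1 ++ l).
  rewrite /= mem_cat cat_uniq ul andbT map_inj_uniq ?iota_uniq; last first.
    by move=> i j [].
  rewrite negb_or /=; apply/andP; split; last first.
    apply/hasPn => v /(allP lm); apply: contraTN => /mapP[j _ ->].
    by rewrite ltnn.
  apply/andP; split; last by apply/negP => /(allP lm); rewrite ltnn.
  apply/mapP => -[j]; rewrite mem_iota => /andP[j1 _] [] j0.
  by rewrite -j0 in j1.
transitivity (\int[P]_x (g [seq vert (X^~ x) m j | j <- iota 1 n]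
    [seq X v x | v <- (m.+1, 0)%N :: l1 ++ l])%:E)%E.
  apply: eq_integral => x _; rewrite /g /= map_cat.
  rewrite take_size_cat ?size_map ?size_iota//.
  rewrite drop_size_cat ?size_map ?size_iota// /l1 -map_comp.
  by have := colstep_vert (X^~ x) m 0 n => /= ->.
rewrite IH//; last 2 first.
- rewrite /= ltnSn all_cat /=; apply/andP; split.
    by apply/allP => v /mapP[j _ ->].
  by apply/allP => v /(allP lm) /=; apply: ltn_trans.
- by move=> s [|b t] /=.
congr (_%:E).
have -> : [seq site_parameter p u v | v <- (m.+1, 0)%N :: l1 ++ l] =
    u :: nseq n p ++ [seq site_parameter p u v | v <- l].
  rewrite /= map_cat /l1 -map_comp; congr (_ :: _ ++ _).
  by apply: map_iota_const => -[].
transitivity (Ebern u (fun a => Eprod (nseq n v0) (fun js =>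
  Eprod (nseq n p) (fun ws => Eprod [seq site_parameter p u v | v <- l]
    (f (colstep a js ws).1))))).
  rewrite Ebern_Eprod_swap; apply: eq_Eprod => js /=.
  apply: eq_Ebern => a; rewrite Eprod_cat; apply: eq_Eprod_size => ws.
  rewrite size_nseq => wn; apply: eq_Eprod => t.
  by rewrite take_size_cat ?drop_size_cat.
rewrite (Eprod_colstep _ _ _ n (fun r =>
  Eprod [seq site_parameter p u v | v <- l] (f r.1)))//=.
by rewrite /Ebern -mulrDl subrKC mul1r.
Qed.

Lemma measurable_vert (d : measure_display) (T : measurableType d)
    (X : site -> T -> bool) (i j : nat) :
  (forall v, measurable_fun setT (X v)) ->
  measurable_fun setT (fun x => vert (X^~ x) i j).
Proof.
move=> mX; elim: i j => [|i IH] [|j] //=.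
have mh : measurable_fun setT
    (fun x => horiz_from (X^~ x) (vert (X^~ x) i) i.+1 j).
  elim: j => [|j IHj] //=; rewrite /hout.
  by apply: measurable_and; [exact: measurable_neg|exact: measurable_or].
rewrite /vout.
by apply: measurable_and; [exact: measurable_neg|exact: measurable_or].
Qed.

(** * Almost sure convergence *)

(** The expected value of the series of the (D N / N)^4 is at most the sum of
    C / N^2, hence finite.  The series then converges almost surely, and its
    terms tend to 0. *)
Lemma ae_cvg_fourth_moment (d : measure_display) (T : measurableType d)
    (R : realType) (P : probability T R) (C : R) (D : nat -> T -> R) :
  0 <= C -> (forall N, measurable_fun setT (D N)) ->
  (forall N, \int[P]_x ((D N x) ^+ 4)%:E <= (C * N%:R ^+ 2)%:E)%E ->
  {ae P, forall x, D N x / N%:R @[N --> \oo] --> 0}.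
Proof.
move=> C0 mD DC.
pose g N x : \bar R := ((D N x / N%:R) ^+ 4)%:E.
have g0 N x : (0 <= g N x)%E by rewrite lee_fin -[4%N]/(2 * 2)%N exprM sqr_ge0.
have mg N : measurable_fun setT (g N).
  apply/measurable_EFinP; apply: measurable_funX.
  by apply: measurable_funM.
have gC N : (\int[P]_x g N x <= (C * (N%:R ^+ 2)^-1)%:E)%E.
  have [->|N0] := posnP N.
    rewrite expr0n /= invr0 mulr0 (eq_integral (cst 0%E)) ?integral0//.
    by move=> x _; rewrite /g invr0 mulr0 expr0n.
  have Np : (0 : R) < N%:R by rewrite ltr0n.
  rewrite (eq_integral (fun x => ((N%:R ^- 4)%:E * ((D N x) ^+ 4)%:E)%E)).
    rewrite ge0_integralZl_EFin//.
    - apply: le_trans (lee_wpmul2l _ (DC N)) _.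
        by rewrite lee_fin invr_ge0 exprn_ge0.
      rewrite -EFinM lee_fin le_eqVlt; apply/orP; left; apply/eqP.
      by field; rewrite gt_eqF.
    - by move=> x _; rewrite lee_fin -[4%N]/(2 * 2)%N exprM sqr_ge0.
    - by apply/measurable_EFinP; apply: measurable_funX.
  by move=> x _; rewrite /g -EFinM exprMn exprVn mulrC.
(* The bound telescopes: 1/(n+1)^2 <= 2/(n+1) - 2/(n+2). *)
have sumC n : \sum_(0 <= N < n.+1) ((N%:R : R) ^+ 2)^-1 <= 2 - 2 / n.+1%:R.
  elim: n => [|n IH]; first by rewrite big_nat1 mulr0n expr0n /= invr0; lra.
  rewrite big_nat_recr//=; apply: le_trans (lerD IH (lexx _)) _.
  have n0 : (0 : R) <= n%:R by rewrite ler0n.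
  rewrite -[n.+2%:R]natr1 -natr1 -subr_ge0.
  rewrite (_ : _ - _ = n%:R / ((n%:R + 1) ^+ 2 * (n%:R + 1 + 1))).
    by rewrite divr_ge0// mulr_ge0 ?exprn_ge0//; lra.
  by field; rewrite !gt_eqF//; lra.
have Ifin : (\int[P]_x (\sum_(N <oo) g N x) < +oo)%E.
  rewrite integral_nneseries//.
  apply: (@le_lt_trans _ _ (C * 2)%:E); last exact: ltry.
  apply: lime_le.
    by apply: is_cvg_nneseries => N _ _; apply: integral_ge0.
  apply: nearW => n.
  apply: le_trans (lee_sum _ _) _; first by move=> N _; exact: gC.
  rewrite sumEFin lee_fin -mulr_sumr ler_wpM2l//.
  case: n => [|n]; first by rewrite big_geq.
  apply: le_trans (sumC n) _.
  by rewrite lerBlDr lerDl divr_ge0.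
have /integrable_ae : P.-integrable setT (fun x => \sum_(N <oo) g N x)%E.
  apply/integrableP; split; first exact: ge0_emeasurable_sum.
  rewrite (eq_integral (fun x => (\sum_(N <oo) g N x)%E))// => x _.
  by rewrite gee0_abs//; apply: nneseries_ge0.
move=> /(_ measurableT); apply: filterS => x /(_ Logic.I) gfin.
have glt : (\sum_(N <oo) g N x < +oo)%E by rewrite ltey_eq gfin.
have tail := @nneseries_tail_cvg R (g^~ x) xpredT glt (fun k _ => g0 k x).
(* Each term is below the tail of the series that starts with it. *)
have g4 : (D N x / N%:R) ^+ 4 @[N --> \oo] --> 0.
  apply: (@fine_cvg _ _ _ _ (g^~ x)).
  apply: (@squeeze_cvge _ _ _ _ (cst 0%E) _
    (fun N => \sum_(N <= k <oo) g k x)%E) => //; last exact: cvg_cst.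
  apply: nearW => N; rewrite g0 /=.
  have := @nneseries_lim_ge R (g^~ x) xpredT N N.+1 (fun k _ _ => g0 k x).
  by rewrite big_nat1.
apply/cvgr0Pnorm_lt => e e0.
have e4 : 0 < e ^+ 4 by rewrite exprn_gt0.
move/cvgr0Pnorm_lt: g4 => /(_ _ e4); apply: filterS => N.
by rewrite normrX ltr_pXn2r// nnegrE ltW.
Qed.

(** The family [Y N] may change with [N], as the vertical increments along the
    line of abscissa floor(Ns) do: the moment bound of [ae_cvg_fourth_moment]
    involves one [N] at a time. *)
Lemma ae_cvg_bernoulli_sum (d : measure_display) (T : measurableType d)
    (R : realType) (P : probability T R) (q s : R) (n : nat -> nat)
    (Y : nat -> nat -> T -> bool) :
  0 <= q <= 1 -> (forall N, (n N)%:R <= N%:R * s) ->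
  (forall N j, measurable_fun setT (Y N j)) ->
  (forall N (f : seq bool -> R), (forall r, 0 <= f r) ->
    (\int[P]_x (f [seq Y N j x | j <- iota 1 (n N)])%:E =
     (Eprod (nseq (n N) q) f)%:E)%E) ->
  {ae P, forall x,
    (\sum_(c <- [seq Y N j x | j <- iota 1 (n N)]) (c%:R - q)) / N%:R
    @[N --> \oo] --> 0}.
Proof.
move=> q01 ns mY YP.
apply: (ae_cvg_fourth_moment _ _ _ P (3 * s ^+ 2)) => [|N|N].
- by rewrite mulr_ge0 ?sqr_ge0.
- exact: (measurable_bits _ _ _ _ (Y N) _ (fun r => \sum_(c <- r) (c%:R - q))).
rewrite (YP N (fun r => (\sum_(c <- r) (c%:R - q)) ^+ 4)); last first.
  by move=> r; rewrite -[4%N]/(2 * 2)%N exprM sqr_ge0.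
rewrite lee_fin; apply: le_trans (Eprod_fourth_moment_le _ _ _ q01) _.
rewrite -mulrA -exprMn ler_wpM2l// [s * _]mulrC ler_sqr ?nnegrE//.
by apply: le_trans (ns N).
Qed.

Lemma centered_count (R : realType) (q : R) (b : nat -> bool) (n : nat) :
  (\sum_(k < n) b k.+1)%:R =
  \sum_(c <- [seq b j | j <- iota 1 n]) (c%:R - q) + n%:R * q :> R.
Proof.
rewrite big_map; have -> : iota 1 n = index_iota 1 n.+1.
  by rewrite /index_iota subn1.
rewrite big_add1 /= big_mkord sumrB sumr_const card_ord natr_sum.
by rewrite -[q *+ n]mulr_natl subrK.
Qed.

Lemma cvg_truncn_ratio (R : realType) (s : R) : 0 <= s ->
  (Num.truncn (N%:R * s))%:R / N%:R @[N --> \oo] --> s.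
Proof.
move=> s0; rewrite -cvg_shiftS.
apply: (@squeeze_cvgr _ _ _ _ (fun N => s - harmonic N) (cst s)); last 2 first.
- rewrite -[X in _ --> X]subr0.
  by apply: cvgB; [exact: cvg_cst|exact: cvg_harmonic].
- exact: cvg_cst.
apply: nearW => N; rewrite /harmonic /=.
have Np : (0 : R) < N.+1%:R by rewrite ltr0n.
have /andP[l1 l2] := truncn_itv (mulr_ge0 (ltW Np) s0).
rewrite ler_pdivlMr// ler_pdivrMr// mulrBl mulVf ?gt_eqF//.
by rewrite (mulrC s) l1 andbT lerBlDr natr1 ltW.
Qed.

Theorem theorem2p1 (d : measure_display) (T : measurableType d) (R : realType)
  (P : probability T R) (p u s t : R) (w : site -> {RV P >-> R})
  (hp : 0 < p < 1) (hu : 0 < u <= 1) (hs : 0 <= s) (ht : 0 <= t)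
  (hw : boundary_environment P p u w) :
  {ae P, forall x : T,
    (fun N : nat =>
       last_passage (fun v : site => w v x)
         (Num.truncn (N%:R * s), Num.truncn (N%:R * t)) / N%:R)
    @ \oo --> s * u + t * (p * (1 - u) / (u + p * (1 - u)))}.
Proof.
pose X := bit (fun v => w v : T -> R).
have XP : independent_bits P (site_parameter p u) X.
  exact: environment_bits.
have [mX _] := XP.
rewrite -/(vertical_parameter p u); set v0 := vertical_parameter p u.
have v01 : 0 <= v0 <= 1 by apply: vertical_parameter_itv.
have u01 : 0 <= u <= 1 by lra.
have D0 : u + p * (1 - u) != 0 by rewrite gt_eqF//; nra.
pose m N := Num.truncn (N%:R * s : R).
pose n N := Num.truncn (N%:R * t : R).
have mle N : (m N)%:R <= N%:R * s :> R.
  by have /andP[] := truncn_itv (mulr_ge0 (ler0n R N) hs).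
have nle N : (n N)%:R <= N%:R * t :> R.
  by have /andP[] := truncn_itv (mulr_ge0 (ler0n R N) ht).
have H1 := ae_cvg_bernoulli_sum d T R P u s m (fun _ j => X (j, 0)%N) u01 mle.
have H2 := ae_cvg_bernoulli_sum d T R P v0 t n
  (fun N j x => vert (X^~ x) (m N) j) v01 nle.
have {}H1 := H1 (fun _ _ => mX _) _.
have {}H2 := H2 (fun _ _ => measurable_vert _ _ _ _ _ mX) _.
have H3 := environment_bit_ae d T R P p u w hp hu hw.
apply: filterS3 (H1 _) (H2 _) H3; last 2 first.
- move=> N f f0.
  have := integral_bits _ _ _ P _ _ X [seq (j, 0)%N | j <- iota 1 (m N)] f XP.
  rewrite map_inj_uniq ?iota_uniq; last by move=> i j [].
  move=> /(_ isT f0); rewrite -map_comp (map_iota_const _ _ u); last first.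
    by case.
  by move=> <-; apply: eq_integral => x _; rewrite -map_comp.
- move=> N f f0.
  exact: (law_vert _ _ _ P p u X (m N) (n N) [::] (fun r _ => f r)).
move=> x c1 c2 wX.
have -> : (fun v => w v x) = (fun v => (X v x)%:R) by apply/funext.
have E : (fun N => last_passage (fun v => (X v x)%:R : R) (m N, n N) / N%:R) =
  (fun N =>
     (\sum_(c <- [seq X (j, 0)%N x | j <- iota 1 (m N)]) (c%:R - u)) / N%:R
     + (m N)%:R / N%:R * u
   + ((\sum_(c <- [seq vert (X^~ x) (m N) j | j <- iota 1 (n N)]) (c%:R - v0))
       / N%:R + (n N)%:R / N%:R * v0)).
  apply/funext => N; rewrite last_passage_flow /flow_passage /= natrD.
  rewrite (centered_count R u (fun k => X (k, 0)%N x)).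
  by rewrite (centered_count R v0) !mulrDl !(mulrAC _ N%:R^-1).
rewrite E; apply: cvgD.
  rewrite -[s * u]add0r; apply: cvgD c1 _; apply: cvgM (cvg_cst _).
  exact: cvg_truncn_ratio.
rewrite -[t * v0]add0r; apply: cvgD c2 _; apply: cvgM (cvg_cst _).
exact: cvg_truncn_ratio.
Qed.
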